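(* Let $k$ be a field of characteristic zero and let $\mathfrak{g}=(\mathfrak{a},\mathfrak{b},\phi,\Omega)$ be a two-step solvable Lie algebra over $k$, given as an extension of an abelian Lie algebra $\mathfrak{b}$ by an abelian Lie algebra $\mathfrak{a}$ with associated representation $\phi\colon\mathfrak{b}\to\mathrm{End}(\mathfrak{a})$ and $2$-cocycle $\Omega\in Z^2(\mathfrak{b},\mathfrak{a})$. If there exists an $e\in\mathfrak{b}$ such that $\phi(e)\in\mathrm{End}(\mathfrak{a})$ is an isomorphism, then $\mathfrak{g}$ admits a Novikov structure. In fact, in that case the product on $\mathfrak{g}=\mathfrak{a}\times\mathfrak{b}$ given by \[ (a,x)\circ(b,y)=\bigl(\phi(x)b+\omega(x,y),\,0\bigr),\qquad \omega(x,y)=\phi(e)^{-1}\phi(x)\Omega(e,y), \] for $a,b\in\mathfrak{a}$ and $x,y\in\mathfrak{b}$, defines a Novikov structure on $\mathfrak{g}$.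
   Context: Notation $\mathfrak{g}=(\mathfrak{a},\mathfrak{b},\phi,\Omega)$: $\mathfrak{a},\mathfrak{b}$ are abelian Lie algebras, $\phi\colon\mathfrak{b}\to\mathrm{End}(\mathfrak{a})$ is a Lie algebra representation (so the operators $\phi(x)$ commute), and $\Omega\colon\mathfrak{b}\times\mathfrak{b}\to\mathfrak{a}$ is a skew-symmetric bilinear map satisfying the $2$-cocycle condition, which for abelian $\mathfrak{b}$ reads $\phi(x)\Omega(y,z)-\phi(y)\Omega(x,z)+\phi(z)\Omega(x,y)=0$ for all $x,y,z\in\mathfrak{b}$. The Lie algebra $\mathfrak{g}$ is the vector space $\mathfrak{a}\times\mathfrak{b}$ with bracket $[(a,x),(b,y)]=(\phi(x)b-\phi(y)a+\Omega(x,y),0)$. A Novikov structure on a Lie algebra $\mathfrak{h}$ over $k$ is a $k$-bilinear product $(x,y)\mapsto x\cdot y$ on $\mathfrak{h}$ satisfying, for all $x,y,z\in\mathfrak{h}$: $x\cdot(y\cdot z)-(x\cdot y)\cdot z=y\cdot(x\cdot z)-(y\cdot x)\cdot z$ (left-symmetry), $(x\cdot y)\cdot z=(x\cdot z)\cdot y$, and $[x,y]=x\cdot y-y\cdot x$. *)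

(* Defs.v *)
From HB Require Import structures.
From mathcomp Require Import all_boot all_order all_algebra.

Set Implicit Arguments.
Unset Strict Implicit.
Unset Printing Implicit Defensive.

Import GRing.Theory.
Local Open Scope ring_scope.

Definition bilinear_map (k : fieldType) (U V W : lmodType k)
    (f : U -> V -> W) : Prop :=
  (forall x, linear (f x)) /\ (forall y, linear (f^~ y)).

Record lieAlgebra (k : fieldType) := LieAlgebra {
  lie_sort :> lmodType k;
  lie_bracket : lie_sort -> lie_sort -> lie_sort;
  lie_bilinear : bilinear_map lie_bracket;
  lie_alternating : forall x, lie_bracket x x = 0;
  lie_jacobi : forall x y z,
    lie_bracket x (lie_bracket y z) + lie_bracket y (lie_bracket z x)
      + lie_bracket z (lie_bracket x y) = 0 }.

Definition lie_abelian (k : fieldType) (h : lieAlgebra k) : Prop :=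
  forall x y : h, lie_bracket x y = 0.

Definition two_step_solvable (k : fieldType) (h : lieAlgebra k) : Prop :=
  forall x y z t : h, lie_bracket (lie_bracket x y) (lie_bracket z t) = 0.

Definition lie_representation (k : fieldType) (b : lieAlgebra k)
    (V : lmodType k) (phi : b -> {linear V -> V}) : Prop :=
  (forall v, linear (fun x => phi x v)) /\
  (forall x y v, phi (lie_bracket x y) v = phi x (phi y v) - phi y (phi x v)).

(* The last condition is the Chevalley-Eilenberg cocycle identity over an
   arbitrary Lie algebra b; its bracket terms vanish when b is abelian. *)
Definition two_cocycle (k : fieldType) (b : lieAlgebra k) (V : lmodType k)
    (phi : b -> {linear V -> V}) (Omega : b -> b -> V) : Prop :=
  [/\ bilinear_map Omega,
      (forall x y, Omega x y = - Omega y x) &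
      (forall x y z,
         phi x (Omega y z) - phi y (Omega x z) + phi z (Omega x y)
         - Omega (lie_bracket x y) z + Omega (lie_bracket x z) y
         - Omega (lie_bracket y z) x = 0)].

Record extData (k : fieldType) := ExtData {
  ext_a : lieAlgebra k;
  ext_b : lieAlgebra k;
  ext_a_abelian : lie_abelian ext_a;
  ext_b_abelian : lie_abelian ext_b;
  ext_phi : ext_b -> {linear ext_a -> ext_a};
  ext_Omega : ext_b -> ext_b -> ext_a;
  ext_phi_rep : lie_representation ext_phi;
  ext_Omega_cocycle : two_cocycle ext_phi ext_Omega }.

Definition ext_bracket (k : fieldType) (g : extData k)
    (u v : ext_a g * ext_b g) : ext_a g * ext_b g :=
  (ext_phi u.2 v.1 - ext_phi v.2 u.1 + ext_Omega u.2 v.2, 0).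

Section ExtensionLie.
Variables (k : fieldType) (hk : [pchar k] =i pred0) (g : extData k).
Implicit Types (x y z : ext_b g) (u v w : ext_a g * ext_b g).

Lemma ext_phiDl x y c (m : ext_a g) :
  ext_phi (c *: x + y) m = c *: ext_phi x m + ext_phi y m.
Proof. by case: (ext_phi_rep g) => h _; rewrite h. Qed.

Lemma ext_phi0 (m : ext_a g) : ext_phi (0 : ext_b g) m = 0.
Proof. by have := ext_phiDl 0 0 (-1) m; rewrite scaler0 addr0 scaleN1r addNr. Qed.

Lemma ext_phi_comm x y (m : ext_a g) :
  ext_phi x (ext_phi y m) = ext_phi y (ext_phi x m).
Proof.
case: (ext_phi_rep g) => _ /(_ x y m).
by rewrite ext_b_abelian ext_phi0 => /esym/eqP; rewrite subr_eq0 => /eqP.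
Qed.

Lemma ext_OmegaC x y : ext_Omega x y = - ext_Omega y x.
Proof. by case: (ext_Omega_cocycle g). Qed.

Lemma ext_OmegaDr x y z c :
  ext_Omega x (c *: y + z) = c *: ext_Omega x y + ext_Omega x z.
Proof. by case: (ext_Omega_cocycle g) => -[h _] _ _; rewrite h. Qed.

Lemma ext_OmegaDl x y z c :
  ext_Omega (c *: x + y) z = c *: ext_Omega x z + ext_Omega y z.
Proof. by case: (ext_Omega_cocycle g) => -[_ h] _ _; rewrite h. Qed.

Lemma ext_Omega0r x : ext_Omega x 0 = 0.
Proof.
by have := ext_OmegaDr x 0 0 (-1); rewrite scaler0 addr0 scaleN1r addNr.
Qed.

Lemma ext_Omegaxx x : ext_Omega x x = 0.
Proof.
have two : (2%:R : k) != 0.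
  by have := hk 2; rewrite !inE /= => ->.
have h : (2%:R : k) *: ext_Omega x x = 0.
  by rewrite scaler_nat mulr2n {1}ext_OmegaC addNr.
by move/eqP: h; rewrite scaler_eq0 (negbTE two) => /eqP.
Qed.

Lemma ext_cocycleE x y z :
  ext_phi x (ext_Omega y z) - ext_phi y (ext_Omega x z)
    + ext_phi z (ext_Omega x y) = 0.
Proof.
case: (ext_Omega_cocycle g) => _ _ /(_ x y z).
rewrite !ext_b_abelian.
have O0l t : ext_Omega (0 : ext_b g) t = 0.
  by rewrite ext_OmegaC ext_Omega0r oppr0.
by rewrite !O0l !subr0 addr0.
Qed.

Lemma ext_bracket_bilinear : bilinear_map (@ext_bracket k g).
Proof.
have split3 c (p q r p' q' r' : ext_a g) :
    c *: p + p' - (c *: q + q') + (c *: r + r')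
    = c *: (p - q + r) + (p' - q' + r').
  by rewrite !scalerDr scalerN opprD (addrACA (c *: p)) (addrACA (c *: p - _)).
split=> [u c v w|v c u w]; rewrite /ext_bracket /=; congr (_, _) => /=;
  rewrite ?scaler0 ?addr0 // linearP ext_phiDl.
- by rewrite ext_OmegaDr split3.
- by rewrite ext_OmegaDl split3.
Qed.

Lemma ext_bracket_alternating u : ext_bracket u u = 0.
Proof. by rewrite /ext_bracket subrr ext_Omegaxx addr0. Qed.

Lemma ext_bracket_jacobi u v w :
  ext_bracket u (ext_bracket v w) + ext_bracket v (ext_bracket w u)
    + ext_bracket w (ext_bracket u v) = 0.
Proof.
have cyc (p q r s t o : ext_a g) :
    (p - q + s) + (r - p + t) + (q - r + o) = s + t + o.
  rewrite (addrACA (p - q)) (addrACA (p - q + _)) -[RHS]add0r.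
  congr (_ + _).
  by rewrite [p - q + _]addrC !subrKA subrr.
case: u v w => [a x] [b y] [c z]; rewrite /ext_bracket.
congr (_, _) => /=; last by rewrite !addr0.
rewrite !ext_phi0 !subr0 !ext_Omega0r !addr0 !linearD !linearN /=.
rewrite (ext_phi_comm y x c) (ext_phi_comm z x b) (ext_phi_comm z y a) cyc.
by have := ext_cocycleE x y z; rewrite (ext_OmegaC x z) linearN opprK.
Qed.

Definition extension : lieAlgebra k :=
  @LieAlgebra k (ext_a g * ext_b g)%type (@ext_bracket k g)
    ext_bracket_bilinear ext_bracket_alternating ext_bracket_jacobi.

(* Two-step solvability is therefore not an extra hypothesis. *)
Lemma extension_two_step_solvable : two_step_solvable extension.
Proof.
move=> u v w t; rewrite /lie_bracket /= /ext_bracket /=.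
by rewrite !ext_phi0 ext_Omega0r subrr addr0.
Qed.

End ExtensionLie.

Definition novikov_structure (k : fieldType) (h : lieAlgebra k)
    (m : h -> h -> h) : Prop :=
  [/\ bilinear_map m,
      (forall x y z, m x (m y z) - m (m x y) z = m y (m x z) - m (m y x) z),
      (forall x y z, m (m x y) z = m (m x z) y) &
      (forall x y, lie_bracket x y = m x y - m y x)].

Definition admits_novikov_structure (k : fieldType) (h : lieAlgebra k) : Prop :=
  exists m : h -> h -> h, novikov_structure m.

(* inv is meant to be the two-sided inverse of phi(e). *)
Definition ext_omega (k : fieldType) (g : extData k) (e : ext_b g)
    (inv : ext_a g -> ext_a g) (x y : ext_b g) : ext_a g :=
  inv (ext_phi x (ext_Omega e y)).

Definition ext_circ (k : fieldType) (g : extData k) (e : ext_b g)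
    (inv : ext_a g -> ext_a g) (u v : ext_a g * ext_b g) : ext_a g * ext_b g :=
  (ext_phi u.2 v.1 + ext_omega e inv u.2 v.2, 0).

(* Main.v *)
Require Import Defs.
From HB Require Import structures.
From mathcomp Require Import all_boot all_order all_algebra.

Set Implicit Arguments.
Unset Strict Implicit.
Unset Printing Implicit Defensive.

Import GRing.Theory.
Local Open Scope ring_scope.

(** Write [a], [b] for the kernel and the quotient of the extension and
    [u o v] for the product [ext_circ].
    Every product [u o v] lies in [a x 0], and left multiplication by an
    element of [a x 0] is zero because [phi] and [omega] vanish when their
    [b]-argument does.  Hence all the products [(u o v) o w] are zero: right
    commutativity is trivial, and left-symmetry reduces to
    [u o (v o w) = v o (u o w)], which holds because the operators [phi x]
    commute with each other and therefore also with the inverse of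
    [phi e] (lemmas [phi_inv_comm] and [ext_circCA]).

    The commutator of the product is the bracket exactly when
    [omega x y - omega y x = Omega x y].  After application of the injective
    map [phi e] this reads
    [phi x (Omega e y) - phi y (Omega e x) = phi e (Omega x y)], which is the
    cocycle identity at [(e, x, y)] (lemma [ext_omega_skew]). *)

Section InvertibleOperator.
Variables (k : fieldType) (g : extData k) (e : ext_b g).
Variable inv : ext_a g -> ext_a g.
Hypotheses (phiK : cancel (ext_phi e) inv) (invK : cancel inv (ext_phi e)).

Lemma phi_inv_comm x m : ext_phi x (inv m) = inv (ext_phi x m).
Proof. by apply: (can_inj phiK); rewrite ext_phi_comm !invK. Qed.

Lemma inv_linear : linear inv.
Proof. by move=> c m n; apply: (can_inj phiK); rewrite linearP !invK. Qed.

Lemma ext_omegaDl c x y z :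
  ext_omega e inv (c *: x + y) z
  = c *: ext_omega e inv x z + ext_omega e inv y z.
Proof. by rewrite /ext_omega ext_phiDl inv_linear. Qed.

Lemma ext_omegaDr c x y z :
  ext_omega e inv x (c *: y + z)
  = c *: ext_omega e inv x y + ext_omega e inv x z.
Proof. by rewrite /ext_omega ext_OmegaDr linearP inv_linear. Qed.

Lemma ext_omega0l x : ext_omega e inv 0 x = 0.
Proof.
by have := ext_omegaDl (-1) 0 0 x; rewrite scaler0 addr0 scaleN1r addNr.
Qed.

Lemma ext_omega0r x : ext_omega e inv x 0 = 0.
Proof.
by have := ext_omegaDr (-1) x 0 0; rewrite scaler0 addr0 scaleN1r addNr.
Qed.

(** Applying the injective map [phi e] to both sides gives the cocycle identity
    at [(e, x, y)]: the formula for [omega] is the solution of that identity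
    for [Omega x y], split into its two terms. *)
Lemma ext_omega_skew x y :
  ext_omega e inv x y - ext_omega e inv y x = ext_Omega x y.
Proof.
apply: (can_inj phiK); rewrite linearB /ext_omega !invK.
apply/esym/eqP; rewrite -subr_eq0 opprB addrCA addrC addrAC.
by have := ext_cocycleE e x y; rewrite addrAC => ->.
Qed.

Lemma ext_circ_bilinear : bilinear_map (ext_circ e inv).
Proof.
split=> [u c v w|v c u w]; rewrite /ext_circ /=; congr (_, _) => /=;
  rewrite ?scaler0 ?addr0 //.
- by rewrite linearP ext_omegaDr scalerDr addrACA.
- by rewrite ext_phiDl ext_omegaDl scalerDr addrACA.
Qed.

Lemma ext_circ_circl u v w : ext_circ e inv (ext_circ e inv u v) w = 0.
Proof. by rewrite /ext_circ /= ext_phi0 ext_omega0l addr0. Qed.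

Lemma ext_circCA u v w :
  ext_circ e inv u (ext_circ e inv v w)
  = ext_circ e inv v (ext_circ e inv u w).
Proof.
rewrite /ext_circ /= !ext_omega0r !addr0 !linearD /= /ext_omega.
by rewrite !phi_inv_comm ext_phi_comm (ext_phi_comm u.2 v.2 (ext_Omega _ _)).
Qed.

Lemma ext_circ_commutator u v :
  ext_bracket u v = ext_circ e inv u v - ext_circ e inv v u.
Proof.
rewrite /ext_bracket /ext_circ; congr (_, _) => /=; last by rewrite subr0.
by rewrite opprD addrACA ext_omega_skew.
Qed.

Lemma ext_circ_novikov (hk : [pchar k] =i pred0) :
  @novikov_structure k (extension hk g) (ext_circ e inv).
Proof.
split.
- exact: ext_circ_bilinear.
- by move=> u v w; rewrite !ext_circ_circl ext_circCA.
- by move=> u v w; rewrite !ext_circ_circl.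
- exact: ext_circ_commutator.
Qed.

End InvertibleOperator.

Theorem proposition4p6 (k : fieldType) (hk : [pchar k] =i pred0)
    (g : extData k) :
  ((exists e : ext_b g, bijective (ext_phi e)) ->
     admits_novikov_structure (extension hk g))
  /\
  (forall (e : ext_b g) (phie_inv : ext_a g -> ext_a g),
     cancel (ext_phi e) phie_inv -> cancel phie_inv (ext_phi e) ->
     @novikov_structure k (extension hk g) (ext_circ e phie_inv)).
Proof.
split=> [[e [inv phiK invK]]|e inv phiK invK]; last exact: ext_circ_novikov.
by exists (ext_circ e inv); apply: ext_circ_novikov.
Qed.
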